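(* Let $\mathcal{A}\in\mathbb{R}^{n_1\times n_2\times n_3}$, let $\tau>0$, $0<p\le 1$, $l=\min(n_1,n_2)$, and let $w\in\mathbb{R}^l$ satisfy $w_1\ge w_2\ge\cdots\ge w_l\ge 0$. Let $\Phi\in\mathbb{R}^{n_3\times r}$ be semi-orthogonal ($\Phi^\top\Phi=I_r$, $r\le n_3$), let $\Phi^c\in\mathbb{R}^{n_3\times(n_3-r)}$ be such that $\overline{\Phi}=[\Phi,\Phi^c]\in\mathbb{R}^{n_3\times n_3}$ satisfies $\overline{\Phi}^\top\overline{\Phi}=I$. Consider $$\min_{\mathcal{X}\in\mathbb{R}^{n_1\times n_2\times n_3}}\ \tau\|\mathcal{X}\|_{\Phi,w,S_p}^p+\tfrac12\|\mathcal{X}-\mathcal{A}\|_F^2 .$$ Then an optimal solution is $\mathcal{X}^*=(\mathcal{Z})_{\overline{\Phi}^\top}$, where $\mathcal{Z}\in\mathbb{R}^{n_1\times n_2\times n_3}$ is the tensor whose frontal slices are $Z^{(i)}=S_{\tau,w,p}\big(A_\Phi^{(i)}\big)$ for $i=1,\dots,r$ and $Z^{(r+j)}=A_{\Phi^c}^{(j)}$ for $j=1,\dots,n_3-r$.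
   Context: For a tensor $\mathcal{X}\in\mathbb{R}^{n_1\times n_2\times n_3}$, $X^{(k)}=\mathcal{X}_{(:,:,k)}$ denotes its $k$-th frontal slice. For a matrix $\Psi\in\mathbb{R}^{n_3\times s}$, the transformed tensor $\mathcal{X}_\Psi\in\mathbb{R}^{n_1\times n_2\times s}$ is the tensor with frontal slices $X_\Psi^{(i)}=\sum_{k=1}^{n_3}\Psi_{k i}X^{(k)}$, $i=1,\dots,s$ (i.e. each mode-3 fiber $x$ is mapped to $\Psi^\top x$). For a matrix $Y$, $\sigma_j(Y)$ denotes its $j$-th smallest singular value. The $\Phi$-transformed weighted Schatten-$p$ tensor norm is defined by $\|\mathcal{X}\|_{\Phi,w,S_p}^p=\sum_{i=1}^{r}\sum_{j=1}^{l}w_j\,\sigma_j\big(X_\Phi^{(i)}\big)^p$. For $\sigma\ge0$ and $c\ge0$ let $x_p(\sigma,c)$ denote a global minimizer of $\min_{x\ge 0}\tfrac12(x-\sigma)^2+c\,x^p$. For a matrix $Y\in\mathbb{R}^{n_1\times n_2}$ with singular value decomposition $Y=U_Y\Sigma_YV_Y^\top$, define $S_{\tau,w,p}(Y)=U_Y\,\mathrm{diag}(\gamma_1,\dots,\gamma_l)\,V_Y^\top$, where $\gamma_j=x_p(\sigma_j(Y),\tau w_j)$ replaces the singular value $\sigma_j(Y)$ (the $j$-th smallest) in $\Sigma_Y$. *)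

(* Defs.v *)
From HB Require Import structures.
From mathcomp Require Import all_boot all_order all_algebra.
From mathcomp Require Import classical_sets reals exp.
Set Implicit Arguments. Unset Strict Implicit. Unset Printing Implicit Defensive.
Import Order.TTheory GRing.Theory Num.Theory.
Local Open Scope ring_scope.

Section Defs.
Variables (R : realType) (n1 n2 : nat).

(* A third-order tensor in R^{n1 x n2 x n3}: the family of its frontal slices. *)
Definition tensor (n3 : nat) := 'I_n3 -> 'M[R]_(n1, n2).

Definition ttransform (n3 s : nat) (Psi : 'M[R]_(n3, s)) (X : tensor n3) : tensor s :=
  fun i => \sum_(k < n3) Psi k i *: X k.

Definition rdiag (s : 'rV[R]_(minn n1 n2)) : 'M[R]_(n1, n2) :=
  \matrix_(i, j) \sum_(k < minn n1 n2 | (i == k :> nat) && (j == k :> nat)) s 0 k.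

Definition orthogonal_mx (m : nat) (U : 'M[R]_m) := U^T *m U = 1%:M.

Definition is_svd (Y : 'M[R]_(n1, n2)) (U : 'M[R]_n1) (s : 'rV[R]_(minn n1 n2))
  (V : 'M[R]_n2) :=
  [/\ orthogonal_mx U, orthogonal_mx V,
      forall j, 0 <= s 0 j,
      forall j k : 'I_(minn n1 n2), (j <= k)%N -> s 0 j <= s 0 k &
      Y = U *m rdiag s *m V^T].

Definition is_singvals (Y : 'M[R]_(n1, n2)) (s : 'rV[R]_(minn n1 n2)) :=
  exists U V, is_svd Y U s V.

(* sigma_j(Y), the j-th smallest singular value (0-indexed j). *)
Definition singval (Y : 'M[R]_(n1, n2)) (j : 'I_(minn n1 n2)) : R :=
  xget 0 (is_singvals Y) 0 j.

Definition wschatten_p (n3 r : nat) (Phi : 'M[R]_(n3, r)) (w : 'I_(minn n1 n2) -> R)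
  (p : R) (X : tensor n3) : R :=
  \sum_(i < r) \sum_(j < minn n1 n2) w j * powR (singval (ttransform Phi X i) j) p.

Definition frob2 (n3 : nat) (X : tensor n3) : R :=
  \sum_(k < n3) \sum_(a < n1) \sum_(b < n2) (X k a b) ^+ 2.

Definition is_xp (p : R) (xp : R -> R -> R) :=
  forall sigma c, 0 <= sigma -> 0 <= c ->
    0 <= xp sigma c /\
    forall x, 0 <= x ->
      (xp sigma c - sigma) ^+ 2 / 2 + c * powR (xp sigma c) p
        <= (x - sigma) ^+ 2 / 2 + c * powR x p.

Definition Sthr (xp : R -> R -> R) (tau : R) (w : 'I_(minn n1 n2) -> R)
  (Y : 'M[R]_(n1, n2)) (U : 'M[R]_n1) (V : 'M[R]_n2) : 'M[R]_(n1, n2) :=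
  U *m rdiag (\row_j xp (singval Y j) (tau * w j)) *m V^T.

End Defs.

(* Main.v *)
(* The orthogonal change of basis [row_mx Phi Phic] preserves the Frobenius norm and decouples
   the objective into one problem per transformed frontal slice. By von Neumann's trace
   inequality, the squared distance between two matrices is at least that between their sorted
   singular values, with equality when they share singular vectors; so each slice reduces to
   the scalar problems solved by [xp]. The thresholded values are again sorted, because [xp] is
   monotone in [sigma] and antitone in [c], hence they are the singular values of the
   thresholded matrix. *)
Require Import Defs.
From mathcomp Require Import all_boot all_order all_algebra.
From mathcomp Require Import classical_sets reals exp.
From mathcomp Require Import function_spaces topology normedtype derive.
From mathcomp Require Import ring lra zify.
Import Order.TTheory GRing.Theory Num.Theory.
Import numFieldNormedType.Exports.
Local Open Scope ring_scope.

Set Implicit Arguments.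
Unset Strict Implicit.
Unset Printing Implicit Defensive.

(** * Symmetric forms and orthogonal matrices *)

Definition dotv {R : realType} {n : nat} (x y : 'rV[R]_n) : R := (x *m y^T) 0 0.

Lemma dotvE (R : realType) (n : nat) (x y : 'rV[R]_n) :
  dotv x y = \sum_k x 0 k * y 0 k.
Proof. by rewrite /dotv mxE; apply: eq_bigr => k _; rewrite mxE. Qed.

Lemma dotvC (R : realType) (n : nat) (x y : 'rV[R]_n) : dotv x y = dotv y x.
Proof. by rewrite !dotvE; apply: eq_bigr => k _; rewrite mulrC. Qed.

Lemma dotvv_ge0 (R : realType) (n : nat) (x : 'rV[R]_n) : 0 <= dotv x x.
Proof. by rewrite dotvE sumr_ge0 // => k _; rewrite -expr2 sqr_ge0. Qed.

Lemma dotvv_eq0 (R : realType) (n : nat) (x : 'rV[R]_n) : dotv x x = 0 -> x = 0.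
Proof.
rewrite dotvE => /eqP; rewrite psumr_eq0 => [/allP x0|k _]; last first.
  by rewrite -expr2 sqr_ge0.
apply/rowP => k; rewrite mxE; apply/eqP.
by have := x0 k (mem_index_enum _); rewrite /= mulf_eq0 orbb.
Qed.

Lemma dot0v (R : realType) (n : nat) (y : 'rV[R]_n) : dotv 0 y = 0.
Proof. by rewrite /dotv mul0mx mxE. Qed.

Lemma mulmx_trE (R : realType) (n : nat) (x y : 'rV[R]_n) : x *m y^T = (dotv x y)%:M.
Proof. by rewrite [LHS]mx11_scalar. Qed.

Lemma dotvDl (R : realType) (n : nat) (x y z : 'rV[R]_n) :
  dotv (x + y) z = dotv x z + dotv y z.
Proof. by rewrite /dotv mulmxDl mxE. Qed.

Lemma dotvDr (R : realType) (n : nat) (x y z : 'rV[R]_n) :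
  dotv x (y + z) = dotv x y + dotv x z.
Proof. by rewrite dotvC dotvDl !(dotvC x). Qed.

Lemma dotvZl (R : realType) (n : nat) (a : R) (x y : 'rV[R]_n) :
  dotv (a *: x) y = a * dotv x y.
Proof. by rewrite /dotv -scalemxAl mxE. Qed.

Lemma dotvZr (R : realType) (n : nat) (a : R) (x y : 'rV[R]_n) :
  dotv x (a *: y) = a * dotv x y.
Proof. by rewrite dotvC dotvZl dotvC. Qed.

Lemma dotv_mull (R : realType) (m n : nat) (x : 'rV[R]_m) (B : 'M[R]_(m, n)) y :
  dotv (x *m B) y = dotv x (y *m B^T).
Proof. by rewrite /dotv trmx_mul trmxK mulmxA. Qed.

(* Householder reflection exchanging the first basis vector and [u]. *)
Lemma orthogonal_with_row0 (R : realType) (m : nat) (u : 'rV[R]_m.+1) :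
  dotv u u = 1 -> exists P : 'M[R]_m.+1, P *m P^T = 1%:M /\ row 0 P = u.
Proof.
move=> u1; have [e e1 eP] : exists2 e : 'rV[R]_m.+1, dotv e e = 1 &
    forall P : 'M[R]_m.+1, row 0 P = e *m P.
  exists (delta_mx 0 0); first by rewrite /dotv trmx_delta mul_delta_mx mxE.
  by move=> P; rewrite rowE.
have [w wE] : exists w : 'rV[R]_m.+1, w = e - u by exists (e - u).
have [c cw] : exists c, c = dotv w w by exists (dotv w w).
(* If [c = 0] then [u] is already the first basis vector, and the identity replaces the undefined
   reflection. *)
have [c0|cN0] := eqVneq c 0.
  exists 1%:M; rewrite trmx1 mulmx1; split => //.
  rewrite eP mulmx1; apply/eqP; rewrite -subr_eq0 -wE.
  by apply/eqP/dotvv_eq0; rewrite -cw.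
(* Both [e] and [u] are unit vectors, so [|e - u|^2 = 2 - 2 <e, u>]; hence the reflection along [w]
   sends [e] to [e - w = u]. *)
have cE : c = 2 * dotv e w.
  rewrite cw wE -scaleN1r !(dotvDl, dotvDr, dotvZl, dotvZr) e1 u1 (dotvC u e).
  by ring.
exists (1%:M - (2 / c) *: (w^T *m w)); split.
  rewrite raddfB /= trmx1 [(_ *: _)^T]linearZ /= trmx_mul trmxK.
  rewrite mulmxBl mul1mx mulmxBr mulmx1 -scalemxAl -scalemxAr.
  rewrite mulmxA -(mulmxA w^T w) mulmx_trE -cw mul_mx_scalar -scalemxAl !scalerA.
  have -> : 2 / c * (2 / c * c) = 2 / c + 2 / c by field.
  by rewrite scalerDl opprB addrK subrK.
rewrite eP mulmxBr mulmx1 -scalemxAr mulmxA.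
rewrite mulmx_trE mul_scalar_mx scalerA (_ : _ * _ = 1) ?scale1r.
  by rewrite wE subKr.
have eN0 : dotv e w != 0 by apply: contraNneq cN0 => h; rewrite cE h mulr0.
by rewrite cE; field.
Qed.

(** A continuous form attains its minimum on the compact unit sphere; homogeneity extends the bound
    to every [x]. *)
Lemma rayleigh_min (R : realType) (n : nat) (B : 'M[R]_n.+1) :
  exists2 v : 'rV[R]_n.+1, dotv v v = 1 &
    forall x, dotv (v *m B) v * dotv x x <= dotv (x *m B) x.
Proof.
have coordc k : continuous (fun x : 'rV[R]_n.+1 => x 0 k) by exact: coord_continuous.
have sumc (F : 'I_n.+1 -> 'rV[R]_n.+1 -> R) : (forall l, continuous (F l)) ->
    continuous (fun x => \sum_l F l x).
  by move=> Fc; apply: continuous_big => [|l _]; [exact: add_continuous|exact: Fc].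
have colc (C : 'M[R]_n.+1) k :
    continuous (fun x : 'rV[R]_n.+1 => \sum_l x 0 l * C l k).
  apply: (sumc (fun l x => x 0 l * C l k)) => l x.
  exact: cvgM (coordc _ x) (cvg_cst _).
have qfc C : continuous (fun x : 'rV[R]_n.+1 => dotv (x *m C) x).
  suff -> : (fun x : 'rV[R]_n.+1 => dotv (x *m C) x) =
      (fun x : 'rV[R]_n.+1 => \sum_k (\sum_l x 0 l * C l k) * x 0 k).
    apply: (sumc (fun k x => (\sum_l x 0 l * C l k) * x 0 k)) => k x.
    exact: cvgM (colc _ _ x) (coordc _ x).
  apply/boolp.funext => x; rewrite dotvE; apply: eq_bigr => k _; by rewrite mxE.
have nrmc : continuous (fun x : 'rV[R]_n.+1 => dotv x x).
  suff -> : (fun x : 'rV[R]_n.+1 => dotv x x) = (fun x => dotv (x *m 1%:M) x).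
    exact: qfc.
  by apply/boolp.funext => x; rewrite mulmx1.
pose S : set 'rV[R]_n.+1 := ((fun x : 'rV[R]_n.+1 => dotv x x) @^-1` [set 1])%classic.
have Scl : closed S by apply: closed_comp => // x _; exact: nrmc.
have Scp : compact S.
  apply: (subclosed_compact Scl
    (@rV_compact R n.+1 (fun=> `[-1, 1]%classic) (fun=> @segment_compact R (-1) 1))).
  move=> x /= x1 i; rewrite in_itv /= -ler_norml.
  rewrite -(@ler_pXn2r _ 2) ?nnegrE // real_normK ?num_real // expr1n.
  rewrite -x1 dotvE (bigD1 i) //= -expr2 lerDl sumr_ge0 // => k _.
  by rewrite -expr2 sqr_ge0.
have S0 : (S !=set0)%classic.
  exists (delta_mx 0 0); rewrite /S /= /dotv trmx_delta mul_delta_mx mxE.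
  by rewrite !eqxx.
have [|v Sv vmin] := compact_EVT_min S0 Scp 
    (f := fun x : 'rV[R]_n.+1 => dotv (x *m B) x).
  by apply: continuous_subspaceT => x; exact: qfc.
exists v; first exact: (set_mem Sv).
move=> x; have [x0|xN0] := eqVneq (dotv x x) 0.
  by rewrite (dotvv_eq0 x0) mul0mx !dot0v mulr0.
have x_gt0 : 0 < dotv x x by rewrite lt_def xN0 dotvv_ge0.
pose r := Num.sqrt (dotv x x).
have r2 : r ^+ 2 = dotv x x by rewrite sqr_sqrtr ?dotvv_ge0.
have rN0 : r != 0 by apply: contraNneq xN0 => h; rewrite -r2 h expr0n.
have := vmin (r^-1 *: x).
have -> : r^-1 *: x \in S.
  rewrite inE /S /= dotvZl dotvZr -r2.
  by field.
move=> /(_ isT); rewrite -scalemxAl dotvZl dotvZr mulrA.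
rewrite -[r^-1 * r^-1]expr2 exprVn r2 mulrC ler_pdivlMr //.
Qed.

(** Along [v + t *: z] with [z = v *m B], the form equals [2 t |z|^2 + t^2 <z B, z>]; this is
    negative for small negative [t] unless [z = 0]. *)
Lemma psd_null (R : realType) (n : nat) (B : 'M[R]_n) (v : 'rV[R]_n) :
  B^T = B -> (forall x, 0 <= dotv (x *m B) x) -> dotv (v *m B) v = 0 ->
  v *m B = 0.
Proof.
move=> Bsym Bpos v0; have [z zE] : exists z : 'rV[R]_n, z = v *m B by exists (v *m B).
rewrite -zE in v0 *; apply: dotvv_eq0.
have key t : 0 <= 2 * t * dotv z z + t ^+ 2 * dotv (z *m B) z.
  have := Bpos (v + t *: z).
  rewrite mulmxDl -scalemxAl -zE !(dotvDl, dotvDr, dotvZl, dotvZr) v0.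
  rewrite (dotv_mull z B v) Bsym -zE.
  by congr (_ <= _); ring.
apply/eqP; rewrite eq_le dotvv_ge0 andbT leNgt; apply/negP => a_gt0.
set a := dotv z z in key a_gt0; set b := dotv (z *m B) z in key.
have b_ge0 : 0 <= b := Bpos z.
(* The vertex of the quadratic is at [- a / b]; using [b + 1] covers [b = 0] and still gives a
   negative value. *)
have := key (- (a / (b + 1))).
rewrite [X in 0 <= X -> _](_ : _ = - (a ^+ 2 / (b + 1) ^+ 2 * (b + 2))); last first.
  by field; apply: lt0r_neq0; lra.
rewrite oppr_ge0 leNgt mulr_gt0 ?divr_gt0 ?exprn_gt0 //; lra.
Qed.

(** The form of [B - lam%:M] is nonnegative and vanishes at the Rayleigh minimizer, so [psd_null]
    makes that minimizer an eigenvector. *)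
Lemma min_eigenvector (R : realType) (n : nat) (B : 'M[R]_n.+1) : B^T = B ->
  exists v : 'rV[R]_n.+1, exists lam : R,
    [/\ dotv v v = 1, v *m B = lam *: v &
        forall x, lam * dotv x x <= dotv (x *m B) x].
Proof.
move=> Bsym; have [v v1 vmin] := rayleigh_min B.
exists v, (dotv (v *m B) v); split=> //; set lam := dotv _ _ in vmin *.
have bE x : dotv (x *m (B - lam%:M)) x = dotv (x *m B) x - lam * dotv x x.
  by rewrite mulmxBr mul_mx_scalar -scaleNr dotvDl dotvZl mulNr.
apply/eqP; rewrite -subr_eq0 -mul_mx_scalar -mulmxBr; apply/eqP/psd_null.
- by rewrite raddfB /= Bsym tr_scalar_mx.
- by move=> x; rewrite bE subr_ge0.
- by rewrite bE v1 mulr1 subrr.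
Qed.

(** * Von Neumann's trace inequality *)

(* [\sum_i x i * y i] bounds [\sum_(k, l) x k * y l * M k l] by linear programming
   duality: the discrete Stieltjes sum [a k] of [y dx] satisfies
   [x k * y l <= a k + (x l * y l - a l)] for all [k] and [l]. *)
Lemma dual_certificate (R : realFieldType) (x y : nat -> R) :
  {homo x : i j / (i <= j)%N >-> i <= j} -> {homo y : i j / (i <= j)%N >-> i <= j} ->
  (forall i, 0 <= x i) -> (forall i, 0 <= y i) ->
  exists a : nat -> R, [/\ forall k, 0 <= a k, forall k, a k <= x k * y k &
    forall k l, x k * y l <= a k + (x l * y l - a l)].
Proof.
move=> xm ym x0 y0.
pose a := fix a k := if k is k'.+1 then a k' + (x k - x k') * y k else x 0%N * y 0%N.
have dx k : 0 <= x k.+1 - x k by rewrite subr_ge0 xm.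
have dy k : 0 <= y k.+1 - y k by rewrite subr_ge0 ym.
exists a; split.
- elim=> [|k IH] /=; first exact: mulr_ge0.
  by rewrite addr_ge0 // mulr_ge0.
- elim=> [|k IH] //=.
  have := mulr_ge0 (x0 k) (dy k); lra.
(* Induction on the gap between the indices: each step costs a one-step increment of one sequence
   times a longer increment of the other, nonnegative by monotonicity. *)
move=> k l; case/orP: (leq_total k l) => [/subnKC <-|/subnKC <-].
  elim: (l - k)%N => [|d IH]; first by rewrite addn0; lra.
  rewrite addnS /=; set m := (k + d)%N in IH *.
  have := mulr_ge0 (dy m) (_ : 0 <= x m - x k).
  rewrite subr_ge0 xm ?leq_addr // => /(_ isT).
  lra.
elim: (k - l)%N => [|d IH]; first by rewrite addn0; lra.
rewrite addnS /=; set m := (l + d)%N in IH *.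
have := mulr_ge0 (dx m) (_ : 0 <= y m.+1 - y l).
rewrite subr_ge0 ym ?(leq_trans (leq_addr d l)) // => /(_ isT).
lra.
Qed.

(** Weak duality: after weighting the certificate by [M], row sums control the terms [a k] and
    column sums the terms [x l * y l - a l]. *)
Lemma rearrangement (R : realFieldType) (m : nat) (x y : 'I_m -> R) (M : 'I_m -> 'I_m -> R) :
  {homo x : i j / (i <= j)%N >-> i <= j} -> {homo y : i j / (i <= j)%N >-> i <= j} ->
  (forall i, 0 <= x i) -> (forall i, 0 <= y i) ->
  (forall k l, 0 <= M k l) ->
  (forall k, \sum_l M k l <= 1) -> (forall l, \sum_k M k l <= 1) ->
  \sum_k \sum_l x k * y l * M k l <= \sum_k x k * y k.
Proof.
case: m x y M => [|m] x y M xm ym x0 y0 M0 Mr Mc; first by rewrite !big_ord0.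
(* The certificate concerns sequences over [nat]; freezing [z] at its last value beyond [m] keeps it
   monotone. *)
pose ext (z : 'I_m.+1 -> R) n := z (inord (minn n m)).
have extm (z : 'I_m.+1 -> R) : {homo z : i j / (i <= j)%N >-> i <= j} ->
    {homo ext z : i j / (i <= j)%N >-> i <= j}.
  by move=> zm i j ij; rewrite /ext; apply: zm; rewrite !inordK ?ltnS ?geq_minr //; lia.
have extE z (i : 'I_m.+1) : ext z i = z i.
  by rewrite /ext (minn_idPl _) ?inord_val // -ltnS.
have [a [a0 axy aP]] := dual_certificate (extm _ xm) (extm _ ym)
  (fun i => x0 _) (fun i => y0 _).
pose b i := ext x i * ext y i - a i.
have b0 i : 0 <= b i by rewrite subr_ge0.
apply: (@le_trans _ _ (\sum_(k < m.+1) \sum_(l < m.+1) (a k * M k l + b l * M k l))).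
  apply: ler_sum => k _; apply: ler_sum => l _; rewrite -mulrDl ler_wpM2r //.
  by rewrite /b; have := aP k l; rewrite !extE.
under eq_bigr do rewrite big_split /=.
rewrite big_split /= [X in _ + X]exchange_big /=.
rewrite [leRHS](_ : _ = \sum_(k < m.+1) a k + \sum_(k < m.+1) b k).
  apply: lerD; apply: ler_sum => k _; rewrite -mulr_sumr ler_piMr //.
rewrite -big_split /=; apply: eq_bigr => k _.
by rewrite /b !extE addrC subrK.
Qed.

(** Meant for sizes such as [n3] and [r + (n3 - r)], which are equal but not convertible. *)
Lemma mulmx1_tr (R : comUnitRingType) (m n : nat) (B : 'M[R]_(m, n)) :
  m = n -> B^T *m B = 1%:M -> B *m B^T = 1%:M.
Proof. by move=> mn; case: n / mn B => B; exact: mulmx1C. Qed.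

Section Singular.
Variables (R : realType) (n1 n2 : nat).
Local Notation l := (minn n1 n2).

Definition ordl : 'I_l -> 'I_n1 := widen_ord (geq_minl n1 n2).
Definition ordr : 'I_l -> 'I_n2 := widen_ord (geq_minr n1 n2).

Lemma sum_rdiag (s : 'rV[R]_l) (F : 'I_n1 -> 'I_n2 -> R) :
  \sum_a \sum_b rdiag s a b * F a b = \sum_k s 0 k * F (ordl k) (ordr k).
Proof.
have E a b : rdiag s a b * F a b =
    \sum_k (if (a == ordl k) && (b == ordr k) then s 0 k * F a b else 0).
  by rewrite mxE mulr_suml big_mkcond.
under eq_bigr do (under eq_bigr do rewrite E; rewrite exchange_big /=).
rewrite exchange_big /=; apply: eq_bigr => k _.
rewrite (bigD1 (ordl k)) //= (bigD1 (ordr k)) //= !eqxx /=.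
rewrite big1 => [|b /negPf ->//]; rewrite big1 ?addr0 // => a /negPf ->.
by rewrite big1.
Qed.

Definition fdot (X Y : 'M[R]_(n1, n2)) : R := \sum_a \sum_b X a b * Y a b.


Definition usv (U : 'M[R]_n1) (s : 'rV[R]_l) (V : 'M[R]_n2) := U *m rdiag s *m V^T.

Lemma usvE U s V a b :
  usv U s V a b = \sum_k s 0 k * (U a (ordl k) * V b (ordr k)).
Proof.
rewrite -(sum_rdiag s (fun i j => U a i * V b j)) mxE exchange_big /=.
apply: eq_bigr => j _; rewrite mxE mxE mulr_suml; apply: eq_bigr => i _.
by rewrite mxE; ring.
Qed.

Lemma fdotE X Y : fdot X Y = \tr (X^T *m Y).
Proof.
rewrite /fdot exchange_big; apply: eq_bigr => b _; rewrite mxE.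
by apply: eq_bigr => a _; rewrite mxE.
Qed.

(** Cyclicity of the trace gathers the outer factors into [U^T *m U'] and [V^T *m V']. *)
Lemma fdot_usv U s V U' s' V' :
  fdot (usv U s V) (usv U' s' V') =
  \sum_k \sum_j s 0 k * s' 0 j *
    ((U^T *m U') (ordl k) (ordl j) * (V^T *m V') (ordr k) (ordr j)).
Proof.
have -> : fdot (usv U s V) (usv U' s' V') =
    fdot (rdiag s) (usv (U^T *m U') s' (V^T *m V')).
  rewrite !fdotE /usv !trmx_mul !trmxK -!mulmxA mxtrace_mulC.
  by rewrite -!mulmxA.
rewrite /fdot sum_rdiag; apply: eq_bigr => k _; rewrite usvE mulr_sumr.
by apply: eq_bigr => j _; rewrite mulrA.
Qed.

Lemma fdot_usv_same U V s s' : orthogonal_mx U -> orthogonal_mx V ->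
  fdot (usv U s V) (usv U s' V) = \sum_k s 0 k * s' 0 k.
Proof.
move=> Uo Vo; rewrite fdot_usv Uo Vo; apply: eq_bigr => k _.
rewrite (bigD1 k) //= !mxE !eqxx !mulr1 big1 ?addr0 // => j jk.
rewrite !mxE -val_eqE /= eq_sym.
by move/negPf: jk; rewrite -val_eqE /= => ->; rewrite mul0r mulr0.
Qed.

(* Von Neumann's trace inequality: [P k j * Q k j <= (P k j ^+ 2 + Q k j ^+ 2) / 2] and the
   right-hand side is doubly substochastic when [P] and [Q] are orthogonal. *)
Lemma von_neumann X U s V Y U' s' V' :
  is_svd X U s V -> is_svd Y U' s' V' -> fdot X Y <= \sum_k s 0 k * s' 0 k.
Proof.
move=> [Uo Vo s0 sm ->] [U'o V'o s'0 s'm ->].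
have [P PE] : exists P, P = U^T *m U' by exists (U^T *m U').
have [Q QE] : exists Q, Q = V^T *m V' by exists (V^T *m V').
have rowsum n (W W' : 'M[R]_n) : orthogonal_mx W -> orthogonal_mx W' ->
    forall i, \sum_j (W^T *m W') i j ^+ 2 = 1.
  move=> Wo W'o i; transitivity (((W^T *m W') *m (W^T *m W')^T) i i).
    by rewrite mxE; apply: eq_bigr => j _; rewrite [(_^T) j i]mxE expr2.
  by rewrite trmx_mul trmxK mulmxA -(mulmxA _ W') (mulmx1C W'o) mulmx1 Wo mxE eqxx.
have colsum n (W W' : 'M[R]_n) : orthogonal_mx W -> orthogonal_mx W' ->
    forall j, \sum_i (W^T *m W') i j ^+ 2 = 1.
  move=> Wo W'o j; rewrite -(rowsum _ _ _ W'o Wo j); apply: eq_bigr => i _.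
  have -> : W'^T *m W = (W^T *m W')^T by rewrite trmx_mul trmxK.
  by rewrite [(_^T) j i]mxE.
(* Only [l] rows and columns of [P] and [Q] enter [M], so their unit sums of squares become upper
   bounds. *)
have subsum n (f : 'I_l -> 'I_n) (F : 'I_n -> R) : injective f ->
    (forall i, 0 <= F i) -> \sum_k F (f k) <= \sum_i F i.
  move=> finj F0.
  rewrite -(big_imset F (h := f) (A := predT)) /=; last by move=> ? ? _ _; exact: finj.
  rewrite [leRHS](bigID (mem (f @: 'I_l))) /= lerDl.
  by apply: sumr_ge0.
have injl : injective ordl by move=> i j /(congr1 val) /= /val_inj.
have injr : injective ordr by move=> i j /(congr1 val) /= /val_inj.
rewrite -/(usv U s V) -/(usv U' s' V') fdot_usv.
pose M (k j : 'I_l) := (P (ordl k) (ordl j) ^+ 2 + Q (ordr k) (ordr j) ^+ 2) / 2.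
apply: (@le_trans _ _ (\sum_k \sum_j s 0 k * s' 0 j * M k j)).
  apply: ler_sum => k _; apply: ler_sum => j _; apply: ler_wpM2l.
    by rewrite mulr_ge0.
  rewrite -PE -QE /M.
  have := sqr_ge0 (P (ordl k) (ordl j) - Q (ordr k) (ordr j)); nra.
apply: rearrangement => //.
- by move=> k j; rewrite /M divr_ge0 ?addr_ge0 ?sqr_ge0.
- move=> k; rewrite /M -mulr_suml big_split /= ler_pdivrMr // mul1r.
  rewrite [leRHS](_ : _ = 1 + 1) //; apply: lerD.
    rewrite -(rowsum _ _ _ Uo U'o (ordl k)) PE.
    by apply: (subsum _ _ (fun j => _ ^+ 2)) => // j; exact: sqr_ge0.
  rewrite -(rowsum _ _ _ Vo V'o (ordr k)) QE.
  by apply: (subsum _ _ (fun j => _ ^+ 2)) => // j; exact: sqr_ge0.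
move=> j; rewrite /M -mulr_suml big_split /= ler_pdivrMr // mul1r.
rewrite [leRHS](_ : _ = 1 + 1) //; apply: lerD.
  rewrite -(colsum _ _ _ Uo U'o (ordl j)) PE.
  by apply: (subsum _ _ (fun j => _ ^+ 2)) => // k; exact: sqr_ge0.
rewrite -(colsum _ _ _ Vo V'o (ordr j)) QE.
by apply: (subsum _ _ (fun j => _ ^+ 2)) => // k; exact: sqr_ge0.
Qed.

(** * Mirsky's inequality and uniqueness of singular values *)

Lemma fdot_svd X U s V : is_svd X U s V -> fdot X X = \sum_k s 0 k ^+ 2.
Proof. by move=> [Uo Vo _ _ ->]; rewrite (fdot_usv_same _ _ Uo Vo). Qed.

Lemma fdotBB X Y : fdot (X - Y) (X - Y) = fdot X X + fdot Y Y - 2 * fdot X Y.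
Proof.
rewrite /fdot mulr_sumr -sumrN -!big_split /=; apply: eq_bigr => a _.
rewrite mulr_sumr -sumrN -!big_split /=; apply: eq_bigr => b _.
by rewrite !mxE; ring.
Qed.

(** After expanding the squares, only the cross terms differ, and these are compared by
    [von_neumann]. *)
Lemma mirsky X U s V Y U' s' V' : is_svd X U s V -> is_svd Y U' s' V' ->
  \sum_k (s 0 k - s' 0 k) ^+ 2 <= fdot (X - Y) (X - Y).
Proof.
move=> svdX svdY.
rewrite fdotBB (fdot_svd svdX) (fdot_svd svdY).
apply: (@le_trans _ _ (\sum_k s 0 k ^+ 2 + \sum_k s' 0 k ^+ 2 -
    2 * \sum_k s 0 k * s' 0 k)).
  rewrite mulr_sumr -sumrN -!big_split /=; apply: ler_sum => k _.
  by rewrite le_eqVlt; apply/orP; left; apply/eqP; ring.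
by rewrite lerD2l lerN2 ler_pM2l // (von_neumann svdX svdY).
Qed.

(** Mirsky's bound for [X] against itself has right-hand side zero. This makes the choice in
    [singval] unambiguous. *)
Lemma singvals_unique (X : 'M[R]_(n1, n2)) s s' : is_singvals X s -> is_singvals X s' -> s = s'.
Proof.
move=> [U [V svd]] [U' [V' svd']].
have := mirsky svd svd'; rewrite subrr [fdot _ _]big1 => [|a _]; last first.
  by rewrite big1 // => b _; rewrite mxE mul0r.
move=> le0; apply/rowP => k; apply/eqP; rewrite -subr_eq0 -sqrf_eq0.
have : \sum_k (s 0 k - s' 0 k) ^+ 2 == 0.
  by rewrite eq_le le0 sumr_ge0 // => j _; exact: sqr_ge0.
rewrite psumr_eq0 => [/allP/(_ k (mem_index_enum _))//|j _].
exact: sqr_ge0.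
Qed.

Lemma singvalE (X : 'M[R]_(n1, n2)) s : is_singvals X s -> forall j, singval X j = s 0 j.
Proof.
move=> Xs j; rewrite /singval; congr (fun_of_matrix _ 0 j).
by apply: xget_unique => // s' Xs'; exact: singvals_unique Xs' Xs.
Qed.

End Singular.

(** * Existence of singular value decompositions *)

Lemma dotv_gram (R : realType) (m n : nat) (Y : 'M[R]_(m, n)) (x : 'rV[R]_n) :
  dotv (x *m (Y^T *m Y)) x = dotv (x *m Y^T) (x *m Y^T).
Proof. by rewrite mulmxA dotv_mull. Qed.

(** The null vector [v] pushes the rank of [Y] below [n.+1], hence below its number of rows, so the
    left kernel is nonzero too. *)
Lemma left_null_vector (R : realType) (m n : nat) (Y : 'M[R]_(m.+1, n.+1))
    (v : 'rV[R]_n.+1) :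
  (n <= m)%N -> v != 0 -> v *m Y^T = 0 ->
  exists2 u : 'rV[R]_m.+1, dotv u u = 1 & u *m Y = 0.
Proof.
move=> nm vN0 vY0.
have rk : (\rank Y < m.+1)%N.
  rewrite -mxrank_tr ltnNge; apply: contra vN0 => rkY.
  have fullY : row_free Y^T.
    by rewrite /row_free eqn_leq rank_leq_row (leq_trans _ rkY).
  by apply/eqP/(row_free_inj fullY); rewrite vY0 mul0mx.
have : kermx Y != 0 by rewrite kermx_eq0 /row_free neq_ltn rk.
move=> /rowV0Pn [u /sub_kermxP uY uN0].
have uu_gt0 : 0 < dotv u u.
  by rewrite lt_def dotvv_ge0 andbT; apply: contraNneq uN0 => /dotvv_eq0 ->.
have [r r_gt0 r2] : exists2 r, 0 < r & r ^+ 2 = dotv u u.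
  by exists (Num.sqrt (dotv u u)); rewrite ?sqrtr_gt0 ?sqr_sqrtr ?ltW.
exists (r^-1 *: u); last by rewrite -scalemxAl uY scaler0.
by rewrite dotvZl dotvZr -r2; field; rewrite gt_eqF.
Qed.

(** Here [v] is a minimal eigenvector of [Y^T *m Y], [s] the square root of its eigenvalue, and [u]
    the normalized image of [v]. *)
Lemma min_singular_pair (R : realType) (m n : nat) (Y : 'M[R]_(m.+1, n.+1)) :
  (n <= m)%N ->
  exists (u : 'rV[R]_m.+1) (v : 'rV[R]_n.+1) (s : R),
    [/\ dotv u u = 1, dotv v v = 1, 0 <= s, u *m Y = s *: v /\ v *m Y^T = s *: u &
      forall x, s ^+ 2 * dotv x x <= dotv (x *m Y^T) (x *m Y^T)].
Proof.
move=> nm; have [|v [lam [v1 vY vmin]]] := min_eigenvector (B := Y^T *m Y).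
  by rewrite trmx_mul trmxK.
have lamE : lam = dotv (v *m Y^T) (v *m Y^T).
  by rewrite -dotv_gram vY dotvZl v1 mulr1.
have lam0 : 0 <= lam by rewrite lamE dotvv_ge0.
have [s s0 s2] : exists2 s, 0 <= s & s ^+ 2 = lam.
  by exists (Num.sqrt lam); rewrite ?sqrtr_ge0 ?sqr_sqrtr.
have bound x : s ^+ 2 * dotv x x <= dotv (x *m Y^T) (x *m Y^T).
  by rewrite s2 -dotv_gram.
(* When [s = 0] the image of [v] vanishes and cannot be normalized; [u] is then taken in the left
   kernel, which is where [n <= m] matters. *)
have [s_eq0|sN0] := eqVneq s 0.
  have vY0 : v *m Y^T = 0 by apply: dotvv_eq0; rewrite -lamE -s2 s_eq0 expr0n.
  have vN0 : v != 0.
    by apply: contraTneq (@oner_neq0 R) => v0; rewrite -v1 v0 dot0v eqxx.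
  have [u u1 uY] := left_null_vector nm vN0 vY0.
  exists u, v, s; split=> //; last by rewrite s_eq0 !scale0r.
exists (s^-1 *: (v *m Y^T)), v, s; split=> //.
- by rewrite dotvZl dotvZr -lamE -s2; field.
- split; last by rewrite scalerA divff // scale1r.
  by rewrite -scalemxAl -mulmxA vY -s2 scalerA expr2 mulKf.
Qed.

(** A sequence over [nat], rather than a row of length [minn m n], lets the induction on sizes shift
    indices without casts. *)
Definition diag_rect {R : realType} (m n : nat) (s : nat -> R) : 'M[R]_(m, n) :=
  \matrix_(i, j) if i == j :> nat then s i else 0.

Lemma diag_rectS (R : realType) (m n : nat) (s : nat -> R) :
  diag_rect m.+1 n.+1 s =
  block_mx (s 0%N)%:M 0 0 (diag_rect m n (fun k => s k.+1)) :> 'M_(1 + m, 1 + n).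
Proof.
apply/matrixP => i j; rewrite -[i]splitK -[j]splitK.
case: (split i) => i'; case: (split j) => j'.
all: rewrite ?(block_mxEul, block_mxEur, block_mxEdl, block_mxEdr) !mxE //=.
all: by rewrite ?ord1 ?(ord1 i') ?(ord1 j').
Qed.

Lemma orthogonal_block (R : realType) (n : nat) (U : 'M[R]_n) :
  orthogonal_mx U -> orthogonal_mx (block_mx 1%:M 0 0 U : 'M_(1 + n)).
Proof.
move=> Uo; rewrite /orthogonal_mx tr_block_mx mulmx_block !trmx0 trmx1.
by rewrite !mul0mx !mulmx0 mulmx1 !addr0 add0r Uo -scalar_mx_block.
Qed.

Lemma block_mx_svd (R : realType) (m n : nat) (U : 'M[R]_m) (V : 'M[R]_n)
    (s : nat -> R) (a : R) :
  block_mx a%:M 0 0 (U *m diag_rect m n s *m V^T) =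
  (block_mx 1%:M 0 0 U : 'M_(1 + m)) *m
    (diag_rect m.+1 n.+1 (fun k => if k is k'.+1 then s k' else a) : 'M_(1 + m, 1 + n)) *m
    (block_mx 1%:M 0 0 V : 'M_(1 + n))^T.
Proof.
rewrite diag_rectS tr_block_mx !mulmx_block.
by rewrite !trmx0 trmx1 !(mul0mx, mulmx0, addr0, add0r) mul1mx mulmx1.
Qed.

Lemma orthogonal_mul (R : realType) (n : nat) (U V : 'M[R]_n) :
  orthogonal_mx U -> orthogonal_mx V -> orthogonal_mx (U *m V).
Proof.
move=> Uo Vo.
by rewrite /orthogonal_mx trmx_mul mulmxA -(mulmxA _ U^T) Uo mulmx1.
Qed.

Lemma dotv_row0 (R : realType) (n : nat) (x y : 'rV[R]_n) :
  dotv (row_mx 0 x : 'rV_(1 + n)) (row_mx 0 y) = dotv x y.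
Proof. by rewrite /dotv tr_row_mx mul_row_col mul0mx add0r. Qed.

Lemma dotv_isometry (R : realType) (m n : nat) (P : 'M[R]_(m, n)) (x y : 'rV[R]_m) :
  P *m P^T = 1%:M -> dotv (x *m P) (y *m P) = dotv x y.
Proof. by move=> Po; rewrite dotv_mull -mulmxA Po mulmx1. Qed.

(* Always splitting off the smallest singular value keeps the diagonal sorted; the lower
   bound [t] carries this through the induction. *)
Lemma svd_tall (R : realType) (n m : nat) (Y : 'M[R]_(m, n)) (t : R) :
  (n <= m)%N -> 0 <= t ->
  (forall x, t ^+ 2 * dotv x x <= dotv (x *m Y^T) (x *m Y^T)) ->
  exists (U : 'M[R]_m) (V : 'M[R]_n) (s : nat -> R),
    [/\ orthogonal_mx U, orthogonal_mx V, t <= s 0%N,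
        {homo s : i j / (i <= j)%N >-> i <= j} & Y = U *m diag_rect m n s *m V^T].
Proof.
elim: n m Y t => [|n IH] m Y t nm t0 tY.
  exists 1%:M, 1%:M, (fun=> t); split=> //; rewrite /orthogonal_mx ?trmx1 ?mulmx1 //.
  by apply/matrixP => ? [].
case: m Y nm tY => // m Y nm tY.
have [u [v [s0 [u1 v1 s00 [uY vY] smin]]]] := min_singular_pair Y nm.
have [P [Po Pu]] := orthogonal_with_row0 u1.
have [Q [Qo Qv]] := orthogonal_with_row0 v1.
have Po' := mulmx1C Po; have Qo' := mulmx1C Qo.
(* In bases starting with [u] and [v], the singular pair equations say that the first row and column
   of [W] vanish off the corner [s0]. *)
have [W WE] : exists W, W = P *m Y *m Q^T by exists (P *m Y *m Q^T).
have Wrow : row 0 W = s0 *: delta_mx 0 0.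
  rewrite WE !row_mul Pu uY -scalemxAl -Qv -row_mul Qo.
  by rewrite rowE mulmx1.
have Wcol : row 0 W^T = s0 *: delta_mx 0 0.
  rewrite WE !trmx_mul trmxK row_mul Qv mulmxA vY -scalemxAl -Pu -row_mul Po.
  by rewrite rowE mulmx1.
pose Y' : 'M[R]_(m, n) := drsubmx (W : 'M_(1 + m, 1 + n)).
have Wblk : W = block_mx s0%:M 0 0 Y' :> 'M_(1 + m, 1 + n).
  rewrite -[LHS](@submxK _ 1 m 1 n); congr block_mx.
  - apply/matrixP => i j; rewrite !ord1 !mxE.
    have /rowP /(_ 0) := Wrow; rewrite !mxE /= mulr1 mulr1n => <-.
    by congr (W _ _); apply: val_inj.
  - apply/matrixP => i j; rewrite !ord1 !mxE.
    have /rowP /(_ (rshift 1 j)) := Wrow; rewrite !mxE /= mulr0 => <-.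
    by congr (W _ _); apply: val_inj.
  - apply/matrixP => i j; rewrite !ord1 !mxE.
    have /rowP /(_ (rshift 1 i)) := Wcol; rewrite !mxE /= mulr0 => <-.
    by congr (W _ _); apply: val_inj.
have [|U' [V' [s [U'o V'o s_ge sm Y'E]]]] := IH m Y' s0 nm s00.
  (* Vectors with zero first coordinate see only the block [Y'], and [P], [Q] preserve norms, so the
     minimality of [s0] becomes the lower bound for [Y']. *)
  move=> x; pose z : 'rV[R]_n.+1 := row_mx (0 : 'rV_1) x; have := smin (z *m Q).
  have -> : z *m Q *m Y^T = z *m W^T *m P.
    by rewrite WE !trmx_mul trmxK !mulmxA -(mulmxA _ P^T) Po' mulmx1.
  have -> : z *m W^T = row_mx 0 (x *m Y'^T) :> 'rV_(1 + m).
    rewrite Wblk; transitivity (row_mx (0 : 'rV_1) x *m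
        (block_mx s0%:M 0 0 Y' : 'M_(1 + m, 1 + n))^T) => //.
    rewrite tr_block_mx mul_row_block.
    by rewrite !trmx0 !mul0mx !mulmx0 !add0r.
  by rewrite (dotv_isometry _ _ Qo) (dotv_isometry _ _ Po) !dotv_row0.
exists (P^T *m (block_mx 1%:M 0 0 U' : 'M_(1 + m))),
  (Q^T *m (block_mx 1%:M 0 0 V' : 'M_(1 + n))), (fun k => if k is k'.+1 then s k' else s0).
split.
- by apply: orthogonal_mul; [rewrite /orthogonal_mx trmxK | exact: orthogonal_block].
- by apply: orthogonal_mul; [rewrite /orthogonal_mx trmxK | exact: orthogonal_block].
(* The bound [tY] tested at [v] reads [t ^+ 2 <= s0 ^+ 2]. *)
- rewrite -(@ler_pXn2r _ 2) ?nnegrE //.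
  have := tY v; rewrite vY dotvZl dotvZr u1 v1 !mulr1 expr2; exact.
- case=> [|i] [|j] //= ij; last exact: sm.
  by rewrite (le_trans s_ge) // sm.
have -> : Y = P^T *m W *m Q.
  by rewrite WE !mulmxA Po' mul1mx -mulmxA Qo' mulmx1.
rewrite trmx_mul trmxK !mulmxA; congr (_ *m _).
rewrite -!mulmxA; congr (_ *m _); rewrite mulmxA.
rewrite Wblk Y'E; exact: block_mx_svd.
Qed.

Lemma rdiag_diag_rect (R : realType) (n1 n2 : nat) (s : nat -> R) :
  rdiag (\row_(k < minn n1 n2) s k) = diag_rect n1 n2 s.
Proof.
apply/matrixP => i j; rewrite !mxE; case: eqP => [ij|ij]; last first.
  by rewrite big1 // => k /andP[/eqP ik /eqP jk]; rewrite ik jk in ij.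
have lt_i : (i < minn n1 n2)%N by rewrite leq_min ltn_ord ij ltn_ord.
rewrite (bigD1 (Ordinal lt_i)) /= ?ij ?eqxx // mxE /= -ij big1 ?addr0 //.
move=> k /andP[/andP[/eqP ik _]].
by rewrite -val_eqE /= ik eqxx.
Qed.

Lemma tr_diag_rect (R : realType) (m n : nat) (s : nat -> R) :
  (diag_rect m n s)^T = diag_rect n m s.
Proof. by apply/matrixP => i j; rewrite !mxE eq_sym; case: eqP => // ->. Qed.

Lemma diag_rect_singvals (R : realType) (n1 n2 : nat) (Y : 'M[R]_(n1, n2)) U V
    (s : nat -> R) :
  orthogonal_mx U -> orthogonal_mx V -> 0 <= s 0%N ->
  {homo s : i j / (i <= j)%N >-> i <= j} -> Y = U *m diag_rect n1 n2 s *m V^T ->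
  is_singvals Y (\row_k s k).
Proof.
move=> Uo Vo s0 sm YE; exists U, V; split=> //.
- by move=> j; rewrite mxE (le_trans s0) // sm.
- by move=> j k jk; rewrite !mxE sm.
by rewrite rdiag_diag_rect.
Qed.

(** The induction starts from the trivial lower bound zero; wide matrices are handled by
    transposition, which exchanges [U] and [V]. *)
Lemma singvals_exist (R : realType) (n1 n2 : nat) (Y : 'M[R]_(n1, n2)) :
  exists s, is_singvals Y s.
Proof.
have trivial_bound m n (Z : 'M[R]_(m, n)) x :
    0 ^+ 2 * dotv x x <= dotv (x *m Z^T) (x *m Z^T).
  by rewrite expr0n mul0r dotvv_ge0.
case/orP: (leq_total n2 n1) => n12.
  have [U [V [s [Uo Vo s0 sm YE]]]] := svd_tall n12 (lexx 0) (trivial_bound _ _ Y).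
  by exists (\row_k s k); exact: diag_rect_singvals YE.
have [U [V [s [Uo Vo s0 sm YE]]]] := svd_tall n12 (lexx 0) (trivial_bound _ _ Y^T).
exists (\row_k s k); apply: (diag_rect_singvals Vo Uo) => //.
by rewrite -[LHS]trmxK YE !trmx_mul trmxK tr_diag_rect mulmxA.
Qed.

Lemma singval_svd (R : realType) (n1 n2 : nat) (Y : 'M[R]_(n1, n2)) :
  exists U V, is_svd Y U (\row_j singval Y j) V.
Proof.
have [s [U [V svd]]] := singvals_exist Y; exists U, V.
suff -> : \row_j singval Y j = s by [].
by apply/rowP => j; rewrite mxE (singvalE (s := s)) //; exists U, V.
Qed.

(** * The proximal problem *)

(* Adding the two optimality inequalities gives
   [(x1 - x2) * (s2 - s1) + (c1 - c2) * (x1 ^ p - x2 ^ p) <= 0]. *)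
Lemma xp_monotone (R : realType) (p : R) (xp : R -> R -> R) (s1 s2 c1 c2 : R) :
  0 < p -> is_xp p xp -> 0 <= s1 -> s1 <= s2 -> 0 <= c2 -> c2 <= c1 ->
  xp s1 c1 <= xp s2 c2.
Proof.
move=> p0 xpP s1_ge0 s12 c2_ge0 c21; rewrite leNgt; apply/negP => x21.
have [x1_ge0 opt1] := xpP s1 c1 s1_ge0 (le_trans c2_ge0 c21).
have [x2_ge0 opt2] := xpP s2 c2 (le_trans s1_ge0 s12) c2_ge0.
have pow21 : powR (xp s2 c2) p < powR (xp s1 c1) p.
  by apply: gt0_ltr_powR; rewrite ?in_itv /= ?andbT ?nnegrE.
have le1 := opt1 _ x2_ge0; have le2 := opt2 _ x1_ge0.
move: pow21 le1 le2; set y1 := powR (xp s1 c1) p; set y2 := powR (xp s2 c2) p.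
move=> pow21 le1 le2.
have sum_le0 : (xp s1 c1 - xp s2 c2) * (s2 - s1) + (c1 - c2) * (y1 - y2) <= 0.
  by move: le1 le2; rewrite !expr2; lra.
have pos1 : 0 <= (xp s1 c1 - xp s2 c2) * (s2 - s1).
  by apply: mulr_ge0; lra.
have pos2 : 0 <= (c1 - c2) * (y1 - y2) by apply: mulr_ge0; lra.
(* Two nonnegative products with nonpositive sum both vanish. Their factors in [xp] and [powR] are
   positive, so [s1 = s2] and [c1 = c2], contradicting [x21]. *)
have /eqP : (xp s1 c1 - xp s2 c2) * (s2 - s1) = 0 by lra.
have /eqP : (c1 - c2) * (y1 - y2) = 0 by lra.
rewrite !mulf_eq0 !subr_eq0 (gt_eqF pow21) (gt_eqF x21) /= orbF => /eqP c12 /eqP s21.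
by move: x21; rewrite c12 s21 ltxx.
Qed.

Lemma Sthr_optimal (R : realType) (n1 n2 : nat) (tau p : R) (w : 'I_(minn n1 n2) -> R)
    (xp : R -> R -> R) (Y : 'M[R]_(n1, n2)) U V :
  0 <= tau -> 0 < p -> (forall j k : 'I_(minn n1 n2), (j <= k)%N -> w k <= w j) ->
  (forall j, 0 <= w j) -> is_xp p xp -> is_svd Y U (\row_j singval Y j) V ->
  let S := Sthr xp tau w Y U V in
  forall X, tau * (\sum_j w j * powR (singval S j) p) + fdot (S - Y) (S - Y) / 2 <=
    tau * (\sum_j w j * powR (singval X j) p) + fdot (X - Y) (X - Y) / 2.
Proof.
move=> tau0 p0 wm w0 xpP svdY S X.
have [Uo Vo s0 sm YE] := svdY.
have sY0 j : 0 <= singval Y j by have := s0 j; rewrite mxE.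
have tw0 j : 0 <= tau * w j by rewrite mulr_ge0.
pose g : 'rV[R]_(minn n1 n2) := \row_j xp (singval Y j) (tau * w j).
(* Along [j] the singular values grow while [tau * w j] decreases, so [xp_monotone] keeps [g]
   sorted. *)
have svdS : is_svd S U g V.
  split=> // [j|j k jk]; rewrite !mxE.
    by have [] := xpP _ _ (sY0 j) (tw0 j).
  apply: (xp_monotone p0 xpP) => //; last by rewrite ler_wpM2l // wm.
  by have := sm j k jk; rewrite !mxE.
have sS j : singval S j = g 0 j by apply: singvalE; exists U, V.
have [U' [V' svdX]] := singval_svd X.
(* Equality case of Mirsky's bound: [S] and [Y] share the singular vectors [U] and [V]. *)
have distS : fdot (S - Y) (S - Y) = \sum_j (g 0 j - singval Y j) ^+ 2.
  rewrite fdotBB (fdot_svd svdS) (fdot_svd svdY) [X in fdot _ X]YE.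
  rewrite [fdot _ _](fdot_usv_same g _ Uo Vo) mulr_sumr -sumrN -!big_split /=.
  by apply: eq_bigr => j _; rewrite !mxE; ring.
have distX : \sum_j (singval X j - singval Y j) ^+ 2 <= fdot (X - Y) (X - Y).
  rewrite (le_trans _ (mirsky svdX svdY)) //; apply: ler_sum => j _.
  by rewrite !mxE.
apply: (@le_trans _ _ (tau * (\sum_j w j * powR (singval X j) p) +
    (\sum_j (singval X j - singval Y j) ^+ 2) / 2)); last first.
  by rewrite lerD2l ler_pM2r ?invr_gt0.
rewrite distS !mulr_sumr !mulr_suml -!big_split /=; apply: ler_sum => j _.
have sX0 : 0 <= singval X j by case: svdX => _ _ /(_ j); rewrite mxE.
have [_ /(_ _ sX0)] := xpP _ _ (sY0 j) (tw0 j).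
by rewrite !mulrA sS mxE ![_ + _ / 2]addrC.
Qed.

(** * Mode-3 transforms of tensors *)

Definition fiber {R : realType} {n1 n2 n3 : nat} (X : tensor R n1 n2 n3) a b : 'rV[R]_n3 :=
  \row_k X k a b.

Lemma ttransformE (R : realType) (n1 n2 n3 s : nat) (Psi : 'M[R]_(n3, s))
    (X : tensor R n1 n2 n3) i a b :
  ttransform Psi X i a b = (fiber X a b *m Psi) 0 i.
Proof.
by rewrite summxE mxE; apply: eq_bigr => k _; rewrite !mxE mulrC.
Qed.

Lemma fiber_ttransform (R : realType) (n1 n2 n3 s : nat) (Psi : 'M[R]_(n3, s))
    (X : tensor R n1 n2 n3) a b :
  fiber (ttransform Psi X) a b = fiber X a b *m Psi.
Proof. by apply/rowP => i; rewrite mxE ttransformE. Qed.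

Lemma frob2_fiber (R : realType) (n1 n2 n3 : nat) (X : tensor R n1 n2 n3) :
  frob2 X = \sum_a \sum_b dotv (fiber X a b) (fiber X a b).
Proof.
rewrite /frob2 exchange_big; apply: eq_bigr => a _.
rewrite exchange_big; apply: eq_bigr => b _.
by rewrite dotvE; apply: eq_bigr => k _; rewrite mxE expr2.
Qed.

(** Fibers, written as rows, are multiplied on the right by [Psi], which is then an isometry. *)
Lemma frob2_ttransform (R : realType) (n1 n2 n3 s : nat) (Psi : 'M[R]_(n3, s))
    (X : tensor R n1 n2 n3) :
  Psi *m Psi^T = 1%:M -> frob2 (ttransform Psi X) = frob2 X.
Proof.
move=> Po; rewrite !frob2_fiber; apply: eq_bigr => a _; apply: eq_bigr => b _.
by rewrite !fiber_ttransform dotv_isometry.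
Qed.

Lemma ttransform_trK (R : realType) (n1 n2 n3 s : nat) (Psi : 'M[R]_(n3, s))
    (Z : tensor R n1 n2 s) i :
  Psi^T *m Psi = 1%:M -> ttransform Psi (ttransform Psi^T Z) i = Z i.
Proof.
move=> Po; apply/matrixP => a b.
by rewrite ttransformE fiber_ttransform -mulmxA Po mulmx1 mxE.
Qed.

Lemma ttransformB (R : realType) (n1 n2 n3 s : nat) (Psi : 'M[R]_(n3, s))
    (X Y : tensor R n1 n2 n3) i :
  ttransform Psi (fun k => X k - Y k) i = ttransform Psi X i - ttransform Psi Y i.
Proof.
by rewrite -sumrB; apply: eq_bigr => k _; rewrite scalerBr.
Qed.

Lemma ttransform_lshift (R : realType) (n1 n2 n3 r s : nat) (Phi : 'M[R]_(n3, r))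
    (Psi : 'M[R]_(n3, s)) (X : tensor R n1 n2 n3) i :
  ttransform (row_mx Phi Psi) X (lshift s i) = ttransform Phi X i.
Proof. by apply: eq_bigr => k _; rewrite row_mxEl. Qed.

Lemma ttransform_rshift (R : realType) (n1 n2 n3 r s : nat) (Phi : 'M[R]_(n3, r))
    (Psi : 'M[R]_(n3, s)) (X : tensor R n1 n2 n3) i :
  ttransform (row_mx Phi Psi) X (rshift r i) = ttransform Psi X i.
Proof. by apply: eq_bigr => k _; rewrite row_mxEr. Qed.

Lemma frob2_fdot (R : realType) (n1 n2 n3 : nat) (X : tensor R n1 n2 n3) :
  frob2 X = \sum_k fdot (X k) (X k).
Proof.
by apply: eq_bigr => k _; apply: eq_bigr => a _; apply: eq_bigr => b _; rewrite expr2.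
Qed.

Lemma frob2_row_mx (R : realType) (n1 n2 n3 r s : nat) (Phi : 'M[R]_(n3, r))
    (Psi : 'M[R]_(n3, s)) (X A : tensor R n1 n2 n3) :
  row_mx Phi Psi *m (row_mx Phi Psi)^T = 1%:M ->
  frob2 (fun k => X k - A k) =
    \sum_i fdot (ttransform Phi X i - ttransform Phi A i)
                (ttransform Phi X i - ttransform Phi A i) +
    \sum_j fdot (ttransform Psi X j - ttransform Psi A j)
                (ttransform Psi X j - ttransform Psi A j).
Proof.
move=> Po; rewrite -(frob2_ttransform _ Po) frob2_fdot big_split_ord /=.
congr (_ + _); apply: eq_bigr => i _.
  by rewrite ttransform_lshift ttransformB.
by rewrite ttransform_rshift ttransformB.
Qed.

(** * Optimality for the tensor problem *)

Unset Implicit Arguments.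

Theorem theorem1 (R : realType) (n1 n2 n3 r : nat)
  (A : tensor R n1 n2 n3) (tau p : R) (w : 'I_(minn n1 n2) -> R)
  (Phi : 'M[R]_(n3, r)) (Phic : 'M[R]_(n3, n3 - r))
  (xp : R -> R -> R)
  (U : 'I_r -> 'M[R]_n1) (V : 'I_r -> 'M[R]_n2) :
  0 < tau -> 0 < p -> p <= 1 ->
  (forall j k : 'I_(minn n1 n2), (j <= k)%N -> w k <= w j) ->
  (forall j, 0 <= w j) ->
  (r <= n3)%N ->
  Phi^T *m Phi = 1%:M ->
  (row_mx Phi Phic)^T *m (row_mx Phi Phic) = 1%:M ->
  is_xp p xp ->
  (forall i : 'I_r,
     is_svd (ttransform Phi A i) (U i) (\row_j singval (ttransform Phi A i) j) (V i)) ->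
  let Z : tensor R n1 n2 (r + (n3 - r)) := fun k =>
    match split k with
    | inl i => Sthr xp tau w (ttransform Phi A i) (U i) (V i)
    | inr j => ttransform Phic A j
    end in
  let Xstar : tensor R n1 n2 n3 := ttransform (row_mx Phi Phic)^T Z in
  forall X : tensor R n1 n2 n3,
    tau * wschatten_p Phi w p Xstar + frob2 (fun k => Xstar k - A k) / 2
      <= tau * wschatten_p Phi w p X + frob2 (fun k => X k - A k) / 2.
Proof.
move=> tau0 p0 _ wm w0 rn _ Po xpP svdA Z Xstar X.
have Po' : row_mx Phi Phic *m (row_mx Phi Phic)^T = 1%:M.
  by apply: mulmx1_tr Po; rewrite subnKC.
(* Orthogonality of the full basis makes the transform of [Xstar] return the slices of [Z]. *)
have XsPhi i : ttransform Phi Xstar i = Sthr xp tau w (ttransform Phi A i) (U i) (V i).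
  rewrite -(ttransform_lshift _ Phic) (ttransform_trK _ _ Po) /Z.
  by rewrite (unsplitK (inl i)).
have XsPhic j : ttransform Phic Xstar j = ttransform Phic A j.
  rewrite -(ttransform_rshift Phi) (ttransform_trK _ _ Po) /Z.
  by rewrite (unsplitK (inr j)).
(* On the complementary slices [Xstar] agrees with [A] and contributes zero, so the comparison
   reduces to the [r] thresholded slices. *)
rewrite !(frob2_row_mx _ _ Po') !mulrDl !addrA lerD //; last first.
  rewrite ler_pM2r ?invr_gt0 //; apply: ler_sum => j _.
  rewrite XsPhic subrr; apply: (@le_trans _ _ 0).
    by rewrite /fdot big1 // => a _; rewrite big1 // => b _; rewrite mxE mul0r.
  by do 2!apply: sumr_ge0 => ? _; rewrite -expr2 sqr_ge0.
rewrite /wschatten_p !mulr_sumr !mulr_suml -!big_split /=; apply: ler_sum => i _.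
have := Sthr_optimal (ltW tau0) p0 wm w0 xpP (svdA i) (ttransform Phi X i).
by rewrite XsPhi !mulr_sumr.
Qed.
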